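(* Let $T\subset\mathbb{N}=\{1,2,\dots\}$ be finite, let $m\ge0$ be an integer and let $r_i\ge0$ be integers for $i\in T$. Let $N(m,\prod_{i\in T}I_i^{r_i},1)$ be the number of monic polynomials of degree $m$ over $\mathbb{F}_q$ which, for each $i\in T$, have exactly $r_i$ distinct monic irreducible factors of degree $i$. Then $$N\Big(m,\prod_{i\in T}I_i^{r_i},1\Big)=q^{m}\sum_{(j_i)_{i\in T}}\mathbf{1}\Big[\sum_{i\in T}i(r_i+j_i)\le m\Big]\prod_{i\in T}\binom{|I_i|}{r_i}q^{-ir_i}q^{-ij_i}\binom{|I_i|-r_i}{j_i}(-1)^{j_i},$$ where the sum runs over all tuples of integers with $0\le j_i\le|I_i|-r_i$ (empty if some $r_i>|I_i|$).
   Context: $\mathbb{F}_q$ is a finite field with $q$ elements; $I_i$ is the set of monic irreducible polynomials of degree $i$ over $\mathbb{F}_q$. $\mathbf{1}[P]$ is $1$ if $P$ is true and $0$ otherwise. *)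

(* Defs.v *)
From HB Require Import structures.
From mathcomp Require Import all_boot all_order all_algebra.
From mathcomp Require Import finmap.

Set Implicit Arguments.
Unset Strict Implicit.
Unset Printing Implicit Defensive.

Import Order.TTheory GRing.Theory Num.Theory.
Local Open Scope ring_scope.

Definition monic_deg (F : finFieldType) (m : nat) : {set {poly_m.+1 F}} :=
  [set f : {poly_m.+1 F} | (polyn f \is monic) && (size f == m.+1)].

(* The set I_i of monic irreducible polynomials of degree i.  As {poly_n F} is
   the finite type of polynomials of size at most n (size = degree + 1), it lives
   in {poly_i.+1 F}. *)
Definition monic_irred (F : finFieldType) (i : nat) : {set {poly_i.+1 F}} :=
  [set P in monic_deg F i | irreducibleb P].

Definition num_irred_factors (F : finFieldType) (i : nat) (f : {poly F}) : nat :=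
  #|[set P in monic_irred F i | P %| f]|.

(* N(m, prod_(i in T) I_i^(r_i), 1); factors are counted without multiplicity. *)
Definition count_poly (F : finFieldType) (T : {fset nat}) (r : T -> nat)
    (m : nat) : nat :=
  #|[set f in monic_deg F m |
      [forall i : T, num_irred_factors (val i) f == r i]]|.

(* Main.v *)
(* With [s_i] the number of degree-[i] monic irreducible factors of [f],
   inclusion-exclusion gives
   [1[s = r] = sum_j (-1)^j 'C(s, r + j) 'C(r + j, r)].  Multiplying over [i] and
   summing over [f], it remains to evaluate [sum_f prod_i 'C(s_i, k_i)], which
   counts the pairs of an [f] and a choice of [k_i] of its irreducible factors
   of each degree [i].  Distinct monic irreducibles are pairwise coprime, so each
   choice, of total degree [d = sum_i i k_i], is contained in the factors of
   exactly the [q ^ (m - d)] multiples of one monic polynomial of degree [d]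
   (none if [d > m]). *)
Require Import Defs.
From HB Require Import structures.
From mathcomp Require Import all_boot all_order all_algebra.
From mathcomp Require Import finmap ring.

Set Implicit Arguments.
Unset Strict Implicit.
Unset Printing Implicit Defensive.

Import Order.TTheory GRing.Theory Num.Theory.
Local Open Scope ring_scope.

(** * Expansion of products of sums, and binomial identities *)

(** The ranges summed over below vary with [i], so the expansion runs over dependent functions. It
    reduces to the expansion over ordinary functions into the tagged union of the [J i]. *)
Lemma bigA_distr_dffun (R : Type) (zero one : R) (times : Monoid.mul_law zero)
    (plus : Monoid.add_law zero times) (I : finType) (J : I -> finType)
    (E : forall i, J i -> R) :
  \big[times/one]_i \big[plus/zero]_(j : J i) E i j =
  \big[plus/zero]_(f : {dffun forall i, J i}) \big[times/one]_i E i (f i).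
Proof.
rewrite (reindex (@dffun_of_fprod I J)) /=; last first.
  exact/onW_bij/dffun_of_fprod_bij.
transitivity (\big[plus/zero]_(t : fprod J)
    \big[times/one]_(i in I) [ffun x => E i x] (t i)); last first.
  by apply: eq_bigr => t _; apply: eq_bigr => i _; rewrite !ffunE.
rewrite big_fprod.
rewrite -(@bigA_distr_big_dep _ _ one times plus I _ (tagged_with J)
  (fun i => untag zero [ffun x => E i x])).
apply: eq_bigr => i _.
apply: etrans (big_tag (fun i => [ffun x => E i x]) i).
by apply: eq_bigr => j _; rewrite ffunE.
Qed.

(** When [r + j <= s], both sides are the trinomial coefficient [s! / (r! j! (s - r - j)!)];
    otherwise both vanish. *)
Lemma mul_bin_bin (s r j : nat) :
  ('C(s, r + j) * 'C(r + j, r) = 'C(s, r) * 'C(s - r, j))%N.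
Proof.
have [le_rjs|lt_srj] := leqP (r + j) s; last first.
  rewrite [in LHS]bin_small //; have [le_rs|lt_sr] := leqP r s.
    by rewrite ['C(s - r, j)]bin_small ?muln0 // ltn_subLR // addnC.
  by rewrite ['C(s, r)]bin_small.
have le_rs : (r <= s)%N by rewrite (leq_trans _ le_rjs) ?leq_addr.
have le_j : (j <= s - r)%N by rewrite leq_subRL.
have e1 := bin_fact le_rjs; have e2 := bin_fact (leq_addr j r).
have e3 := bin_fact le_rs; have e4 := bin_fact le_j.
have pos : (0 < r`! * j`! * (s - (r + j))`!)%N by rewrite !muln_gt0 !fact_gt0.
apply/eqP; rewrite -(eqn_pmul2r pos); apply/eqP.
transitivity s`!.
  rewrite -e1 -e2 addKn; ring.
rewrite -e3 -e4 subnDA; ring.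
Qed.

(** By [mul_bin_bin] the sum is ['C(s, r)] times the binomial expansion of [(1 - 1) ^ (s - r)]. The
    bound [n] does not depend on [s], so one range of [j] can serve all polynomials at once. *)
Lemma eq_indicator_bin (R : comNzRingType) (n s r : nat) : (s <= n)%N ->
  (s == r)%:R = \sum_(j < n.+1 - r)
    (-1) ^+ j * ('C(s, r + j) * 'C(r + j, r))%:R :> R.
Proof.
move=> le_sn; under eq_bigr => j _ do rewrite mul_bin_bin natrM mulrCA.
rewrite -mulr_sumr; have [le_rs|lt_sr] := leqP r s; last first.
  by rewrite bin_small // mul0r ltn_eqF.
have le_sr : ((s - r).+1 <= n.+1 - r)%N.
  by rewrite subSn ?(leq_trans le_rs) // ltnS leq_sub2r.
(* The terms with [j > s - r] vanish, so the range can be cut down to that of the binomial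
   theorem. *)
rewrite -(big_mkord xpredT (fun j => (-1) ^+ j * 'C(s - r, j)%:R)).
rewrite (big_cat_nat (leq0n _) le_sr) //= [X in _ + X]big1_seq ?addr0; last first.
  by move=> j; rewrite mem_index_iota => /andP[_ /andP[lt_j _]]; rewrite bin_small ?mulr0.
have := exprDn (1 : R) (-1) (s - r); rewrite subrr expr0n subn_eq0 big_mkord.
under eq_bigr => j _ do rewrite expr1n mul1r -mulr_natr.
move=> <-; rewrite eqn_leq le_rs andbT.
case: leqP => [le_s|]; last by rewrite mulr0.
by rewrite (@anti_leq r s) ?le_rs // binn mulr1.
Qed.

(** * Coprimality, divisibility and degrees of products *)

Section Polynomials.

Variable F : fieldType.

Lemma coprimep_prodr (I : Type) (s : seq I) (P : pred I) (p : I -> {poly F})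
    (q : {poly F}) :
  (forall i, P i -> coprimep q (p i)) ->
  coprimep q (\prod_(i <- s | P i) p i).
Proof.
move=> co; apply: (big_ind (fun x => coprimep q x)) => //; first exact: coprimep1.
by move=> x y ? ?; rewrite coprimepMr; apply/andP.
Qed.

Lemma dvdp_prod_coprime (I : finType) (P : pred I) (p : I -> {poly F})
    (f : {poly F}) :
  {in P &, forall i j, i != j -> coprimep (p i) (p j)} ->
  (\prod_(i | P i) p i %| f) = [forall (i | P i), p i %| f].
Proof.
move=> co; rewrite -big_filter.
transitivity (all (fun i => p i %| f) (filter P (index_enum I))); last first.
  apply/allP/forall_inP => [h i Pi|h i].
    by apply: h; rewrite mem_filter mem_index_enum andbT.
  by rewrite mem_filter => /andP[Pi _]; apply: h.
have: {subset filter P (index_enum I) <= P} by move=> i; rewrite mem_filter => /andP[].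
(* Without repetitions in the list, the head differs from every later index, hence is coprime to the
   remaining product, and Gauss's lemma applies. *)
have := filter_uniq P (index_enum_uniq I).
elim: filter => [|i s IHs] /=; first by rewrite big_nil dvd1p.
case/andP=> i_s uniq_s sP; rewrite big_cons.
have sP' : {subset s <= P} by move=> j js; apply: sP; rewrite inE js orbT.
rewrite Gauss_dvdp ?IHs // big_seq; apply: coprimep_prodr => j js.
apply: co; [by apply: sP; rewrite inE eqxx | exact: sP' |].
by apply: contraNneq i_s => ->.
Qed.

Lemma size_prod_monic (I : Type) (s : seq I) (P : pred I) (p : I -> {poly F}) :
  (forall i, P i -> p i \is monic) ->
  (size (\prod_(i <- s | P i) p i)%R).-1 = (\sum_(i <- s | P i) (size (p i)).-1)%N.
Proof.
(* Monicity is carried through the induction: it keeps the partial products nonzero, so that degrees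
   add. *)
move=> mon; suff [] : \prod_(i <- s | P i) p i \is monic /\
  (size (\prod_(i <- s | P i) p i)%R).-1 =
    (\sum_(i <- s | P i) (size (p i)).-1)%N by [].
apply: (big_rec2 (fun D n => D \is monic /\ (size D).-1 = n)).
  by rewrite monic1 size_poly1.
move=> i D n Pi [monD <-]; split; first by rewrite rpredM ?mon.
have pi_gt0 : (0 < size (p i))%N by rewrite size_poly_gt0 monic_neq0 ?mon.
have D_gt0 : (0 < size D)%N by rewrite size_poly_gt0 monic_neq0.
rewrite size_monicM ?mon ?monic_neq0 //.
by case: (size (p i)) pi_gt0 => // a _; case: (size D) D_gt0 => // b _; rewrite addnS.
Qed.

(** If not coprime to [q], the irreducible [p] divides [q]; being nonconstant, it is then associate
    to [q], and monic associates are equal. *)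
Lemma coprimep_monic_irreducible (p q : {poly F}) :
  irreducible_poly p -> irreducible_poly q -> p \is monic -> q \is monic ->
  p != q -> coprimep p q.
Proof.
move=> irr_p irr_q mon_p mon_q; rewrite irreducible_poly_coprime //.
apply: contraNN => pq; rewrite -eqp_monic //.
by apply: (apply_irredp irr_q) => //; case: irr_p => + _; case: size => [|[]].
Qed.

End Polynomials.

(** * Counting monic polynomials with prescribed irreducible divisors *)

Section MonicCount.

Variable F : finFieldType.

Lemma card_monic_deg (n : nat) : #|monic_deg F n| = (#|F| ^ n)%N.
Proof.
rewrite -card_npoly -cardsT.
(* Adding the leading term ['X^n] is a bijection from the polynomials of size at most [n]. *)
pose h (g : {poly_n F}) : {poly_n.+1 F} := npolyp n.+1 ('X^n + g).
have lt_g (g : {poly_n F}) : (size (polyn g) < size ('X^n : {poly F}))%N.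
  by rewrite size_polyXn ltnS size_npoly.
have sz (g : {poly_n F}) : size ('X^n + polyn g) = n.+1.
  by rewrite size_polyDl // size_polyXn.
have hE (g : {poly_n F}) : polyn (h g) = 'X^n + polyn g by rewrite npolypK ?sz.
have h_inj : injective h.
  by move=> g1 g2 /(congr1 (@polyn _ _)); rewrite !hE => /addrI /val_inj.
rewrite -(card_imset _ h_inj); apply: eq_card => f; rewrite inE.
apply/andP/imsetP => [[mon /eqP sf]|[g _ ->]]; last first.
  by rewrite hE sz monicE lead_coefDl // lead_coefXn.
have fn : (polyn f)`_n = 1 by move: mon; rewrite monicE /lead_coef sf => /eqP.
have le_f : (size (polyn f - 'X^n)%R <= n)%N.
  apply/leq_sizeP => j; rewrite leq_eqVlt => /predU1P[<-|lt_nj].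
    by rewrite coefB coefXn eqxx fn subrr.
  by rewrite coefB coefXn gtn_eqF // nth_default ?sf ?subrr.
exists (npolyp n (polyn f - 'X^n)) => //.
by apply: val_inj => /=; rewrite hE npolypK // addrC subrK.
Qed.

Lemma card_monic_deg_dvdp (m : nat) (D : {poly F}) : D \is monic ->
  #|[set f in monic_deg F m | D %| polyn f]| =
  (((size D).-1 <= m) * #|F| ^ (m - (size D).-1))%N.
Proof.
move=> monD; have D_neq0 := monic_neq0 monD.
have /prednK szD : (0 < size D)%N by rewrite size_poly_gt0.
set d := (size D).-1 in szD *; have [le_dm|lt_md] := leqP d m; last first.
  apply/eqP; rewrite mul0n cards_eq0; apply/eqP/setP => f; rewrite !inE.
  apply/negP => /andP[/andP[mon /eqP sf] /dvdp_leq].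
  by rewrite monic_neq0 // sf -szD ltnS leqNgt lt_md => /(_ isT).
rewrite mul1n -card_monic_deg.
(* Multiplication by [D] is a bijection from the monic polynomials of degree [m - d] onto the
   multiples being counted. *)
pose h (g : {poly_(m - d).+1 F}) : {poly_m.+1 F} := npolyp m.+1 (D * g).
have szh (g : {poly_(m - d).+1 F}) : (size (D * polyn g)%R <= m.+1)%N.
  apply: leq_trans (size_polyMleq _ _) _; rewrite -szD addSn /=.
  by apply: leq_trans (leq_add (leqnn d) (size_npoly g)) _; rewrite addnS subnKC.
have hE g : polyn (h g) = D * polyn g by rewrite npolypK.
have h_inj : injective h.
  move=> g1 g2 /(congr1 (@polyn _ _)); rewrite !hE => /(mulfI D_neq0).
  exact: val_inj.
rewrite -(card_imset _ h_inj); apply: eq_card => f; rewrite !inE.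
apply/andP/imsetP => [[/andP[mon /eqP sf] /dvdpP[g fE]]|[g + ->]]; last first.
  rewrite inE hE monicMl // => /andP[mon_g /eqP sg].
  rewrite mon_g dvdp_mulr // size_monicM ?monic_neq0 // sg -szD addSn addnS /=.
  by rewrite subnKC.
move: mon sf; rewrite fE monicMr // => mon_g.
rewrite size_Mmonic ?monic_neq0 // -szD addnS /= => sg.
have {}sg : size g = (m - d).+1 by rewrite -subSn // -sg addnK.
exists (npolyp (m - d).+1 g); first by rewrite inE npolypK ?sg // mon_g /=.
by apply: val_inj; rewrite /= hE npolypK ?sg // mulrC.
Qed.

(** All chosen irreducibles are pairwise coprime, those of different indices because injectivity of
    [d] gives them different degrees. Divisibility by all of them is thus divisibility by their
    product, whose degree is the sum. *)
Lemma card_dvdp_irred_family (I : finType) (d : I -> nat)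
    (A : forall i, {set {poly_(d i).+1 F}}) (m : nat) :
  injective d -> (forall i, A i \subset monic_irred F (d i)) ->
  #|[set f in monic_deg F m | [forall i, [forall P in A i, polyn P %| polyn f]]]| =
  ((\sum_i d i * #|A i| <= m) * #|F| ^ (m - \sum_i d i * #|A i|))%N.
Proof.
move=> d_inj sA.
have AP i P : P \in A i -> [/\ polyn P \is monic, size (polyn P) = (d i).+1 &
    irreducible_poly (polyn P)].
  by move/(subsetP (sA i)); rewrite !inE => /andP[/andP[? /eqP ?] /irreducibleP].
pose D i := \prod_(P in A i) polyn P.
have monD i : D i \is monic by apply: monic_prod => P /AP[].
have coA i : {in A i &, forall P Q, P != Q -> coprimep (polyn P) (polyn Q)}.
  move=> P Q /AP[mP _ iP] /AP[mQ _ iQ] neq.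
  by apply: coprimep_monic_irreducible => //; apply: contraNneq neq => /val_inj ->.
have coD : {in xpredT &, forall i j, i != j -> coprimep (D i) (D j)}.
  move=> i j _ _ neq; apply: coprimep_prodr => Q /AP[mQ sQ iQ].
  rewrite coprimep_sym; apply: coprimep_prodr => P /AP[mP sP iP].
  apply: coprimep_monic_irreducible => //; apply: contraNneq neq => eQP.
  by apply/eqP/d_inj/succn_inj; rewrite -sP -sQ eQP.
have szD : (size (\prod_i D i)%R).-1 = (\sum_i d i * #|A i|)%N.
  rewrite size_prod_monic //; apply: eq_bigr => i _.
  rewrite size_prod_monic => [|P /AP[]//].
  by rewrite mulnC -sum_nat_const; apply: eq_bigr => P /AP[_ ->].
rewrite -szD -card_monic_deg_dvdp ?monic_prod //; apply: eq_card => f.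
rewrite !inE dvdp_prod_coprime //; congr (_ && _); apply: eq_forallb => i.
by rewrite /= dvdp_prod_coprime.
Qed.

(** Double counting: each binomial counts the [k i]-subsets [A i] of a set of irreducibles.
    Expanding both sides over families [A] allows a comparison family by family. *)
Lemma sum_prod_bin_num_irred (I : finType) (d k : I -> nat) (m : nat) :
  injective d ->
  (\sum_(f in monic_deg F m) \prod_i 'C(num_irred_factors (d i) (polyn f), k i))%N =
  (\prod_i 'C(#|monic_irred F (d i)|, k i) *
    ((\sum_i d i * k i <= m) * #|F| ^ (m - \sum_i d i * k i)))%N.
Proof.
move=> d_inj.
pose J i : finType := {set {poly_(d i).+1 F}}.
have binE i (B : {set {poly_(d i).+1 F}}) :
    'C(#|B|, k i) = (\sum_(A : J i) ((A \subset B) && (#|A| == k i)))%N.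
  rewrite -cards_draws -sum1dep_card big_mkcond; apply: eq_bigr => A _.
  by case: ifP.
under eq_bigr => f _ do under eq_bigr => i _ do rewrite binE.
under eq_bigr => f _ do rewrite (bigA_distr_dffun _ _ (J := J)).
rewrite exchange_big /=.
under [in RHS]eq_bigr => i _ do rewrite binE.
rewrite (bigA_distr_dffun _ _ (J := J)) big_distrl /=.
apply: eq_bigr => A _.
have prodE (E : I -> bool) : (\prod_i E i = [forall i, E i] :> nat)%N.
  case: (boolP [forall i, E i]) => [/forallP h|/forallPn[i /negPf Ei]].
    by rewrite big1 // => i _; rewrite h.
  by rewrite (bigD1 i) //= Ei.
(* An admissible family has [k i] elements of [monic_irred F (d i)] for each [i]. Any other family
   contributes zero on both sides, since the irreducible factors of [f] of degree [d i] lie in that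
   set. *)
rewrite prodE; case: (boolP [forall i, _]) => [/forallP hA|].
  have kE i : #|A i| = k i by have /andP[_ /eqP] := hA i.
  have sA i : A i \subset monic_irred F (d i) by have /andP[] := hA i.
  rewrite mul1n -(eq_bigr _ (fun i _ => congr1 (muln (d i)) (kE i))).
  rewrite -card_dvdp_irred_family // -sum1dep_card big_mkcondr /=.
  apply: eq_bigr => f _; rewrite prodE; congr (nat_of_bool _).
  apply: eq_forallb => i; rewrite kE eqxx andbT.
  apply/subsetP/forall_inP => [h P PA|h P PA].
    by have := h _ PA; rewrite inE => /andP[].
  by rewrite inE h // (subsetP (sA i)).
move=> nA; rewrite mul0n big1 // => f _; rewrite prodE.
case: forallP => // h; case/negP: nA; apply/forallP => i.
case/andP: (h i) => sAi ->; rewrite andbT; apply: subset_trans sAi _.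
by apply/subsetP => P; rewrite inE => /andP[].
Qed.

End MonicCount.

(* With truncated subtraction, 'I_(#|I_i|.+1 - r_i) is {0, .., #|I_i| - r_i}
   when r_i <= #|I_i| and is empty when r_i > #|I_i|. *)
Theorem corollary7 (F : finFieldType) (q : nat) (hq : #|F| = q)
    (T : {fset nat}) (hT : forall i : T, (0 < val i)%N)
    (m : nat) (r : T -> nat) :
  (count_poly F r m)%:R =
  q%:R ^+ m *
  \sum_(j : {dffun forall i : T, 'I_(#|monic_irred F (val i)|.+1 - r i)})
    (\sum_(i : T) val i * (r i + j i) <= m)%N%:R *
    \prod_(i : T)
      ('C(#|monic_irred F (val i)|, r i)%:R
        * q%:R ^- (val i * r i) * q%:R ^- (val i * j i)
        * 'C(#|monic_irred F (val i)| - r i, j i)%:R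
        * (-1) ^+ (j i)) :> rat.
Proof.
have val_T_inj : injective (val : T -> nat) by exact: val_inj.
rewrite /count_poly -sum1dep_card natr_sum big_mkcondr /=.
pose J i : finType := 'I_(#|monic_irred F (val i)|.+1 - r i).
transitivity (\sum_(f in monic_deg F m) \prod_(i : T) \sum_(j : J i)
    (-1) ^+ j * ('C(num_irred_factors (val i) (polyn f), r i + j)
      * 'C(r i + j, r i))%:R : rat).
  apply: eq_bigr => f _.
  under [RHS]eq_bigr => i _.
    (* Taken with [n] equal to [#|monic_irred F (val i)|], which bounds the number of factors of
       every [f]. *)
    rewrite -(@eq_indicator_bin rat); last first.
      by apply/subset_leq_card/subsetP => P; rewrite inE => /andP[].
    over.
  rewrite -natr_prod; case: (boolP [forall i, _]) => [/forallP h|/forallPn[i ne]].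
    by rewrite big1 // => i _; rewrite h.
  by rewrite (bigD1 i) //= (negPf ne).
transitivity (\sum_(f in monic_deg F m) \sum_(j : {dffun forall i, J i})
    \prod_(i : T) ((-1) ^+ j i *
      ('C(num_irred_factors (val i) (polyn f), r i + j i)
        * 'C(r i + j i, r i))%:R) : rat).
  apply: eq_bigr => f _.
  exact: (@bigA_distr_dffun rat 0 1 *%R +%R T J (fun i j => (-1) ^+ j *
    ('C(num_irred_factors (val i) (polyn f), r i + j) * 'C(r i + j, r i))%:R)).
(* With the sum over [f] innermost, the two sides are compared for each fixed [j]. *)
rewrite exchange_big mulr_sumr /=; apply: eq_bigr => j _.
transitivity (\prod_(i : T) ((-1) ^+ j i * 'C(r i + j i, r i)%:R) *
   (\sum_(f in monic_deg F m) \prod_(i : T)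
     'C(num_irred_factors (val i) (polyn f), r i + j i))%N%:R : rat).
  rewrite natr_sum mulr_sumr; apply: eq_bigr => f _.
  rewrite natr_prod -big_split; apply: eq_bigr => i _ /=.
  by rewrite natrM mulrCA mulrC -!mulrA mulrC -mulrA.
rewrite sum_prod_bin_num_irred // hq.
set S := (\sum_i _)%N; rewrite !natrM.
(* Both sides vanish if [S > m]. Otherwise the subtraction in [q ^ (m - S)] is not truncated and the
   power splits over [i]. *)
have [le_Sm|_] := leqP S m; last by rewrite !(mul0r, mulr0).
have q_neq0 : q%:R != 0 :> rat.
  by rewrite pnatr_eq0 -hq -lt0n; apply/card_gt0P; exists 0.
have -> : (q ^ (m - S))%:R =
    q%:R ^+ m * \prod_(i : T) q%:R ^- (val i * (r i + j i)) :> rat.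
  by rewrite natrX expfB_cond ?(negPf q_neq0) // prodfV -expr_sum.
rewrite !mul1r natr_prod [RHS]mulrC !mulrA mulrAC; congr (_ * _).
rewrite -!big_split; apply: eq_bigr => i _ /=.
rewrite mulnDr exprD invfM -(mulrA ((-1) ^+ j i)) -natrM.
(* The trinomial identity again, now with [#|monic_irred F (val i)|] in place of the number of
   factors of [f]. *)
rewrite [X in X%:R]mulnC mul_bin_bin natrM.
rewrite [RHS]mulrC -[LHS]mulrA; congr (_ * _).
by rewrite -!mulrA; congr (_ * _); rewrite [LHS]mulrC -mulrA.
Qed.
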